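(* Let $\mathcal{S}(132)$ denote the set of all permutations of all lengths $n\ge 0$ (including the empty permutation) that avoid the classical pattern $1\text{-}3\text{-}2$. For a permutation $\pi=\pi_1\cdots\pi_n$ define $e_1(\pi)=n$, $e_2(\pi)=\#\{i:\pi_i<\pi_{i+1}\}$ (the number of occurrences of the generalized pattern $12$, i.e. adjacent ascents), and for $k\ge 3$ let $e_k(\pi)$ be the number of occurrences of the generalized pattern $12\text{-}3\text{-}\cdots\text{-}k$, i.e. the number of index tuples $(i,j_3,\dots,j_k)$ with $i+1<j_3<j_4<\cdots<j_k$ and $\pi_i<\pi_{i+1}<\pi_{j_3}<\cdots<\pi_{j_k}$. For $n\ge 0$ put $P_n=\prod_{k=0}^{n} x_{k+2}^{\binom{n}{k}}$, where $x_1,x_2,\dots$ are indeterminates. Then $$\sum_{\pi\in\mathcal{S}(132)}\prod_{k\ge1}x_k^{e_k(\pi)}=\cfrac{1}{1-x_1+x_1P_0-\cfrac{x_1P_0}{1-x_1+x_1P_1-\cfrac{x_1P_1}{1-x_1+x_1P_2-\cfrac{x_1P_2}{\ddots}}}},$$ so that the $(n+1)$st numerator is $x_1\prod_{k=0}^n x_{k+2}^{\binom nk}$.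
   Context: Identity of formal power series in the indeterminates $x_1,x_2,\dots$; a permutation avoids $1\text{-}3\text{-}2$ if it has no indices $a<b<c$ with $\pi_a<\pi_c<\pi_b$. *)

(* Defs.v *)
From HB Require Import structures.
From mathcomp Require Import all_boot all_order all_algebra all_fingroup finmap.
From mathcomp Require Import boolp classical_sets functions cardinality fsbigop.
From mathcomp Require Import xfinmap monalg.

Set Implicit Arguments.
Unset Strict Implicit.
Unset Printing Implicit Defensive.

Import GRing.Theory.
Local Open Scope classical_set_scope.
Local Open Scope ring_scope.

(* Formal power series over R in the (possibly infinitely many) commuting     *)
(* indeterminates indexed by I: arbitrary functions on the finitely supported *)
(* exponent vectors {cmonom I}. A record is used instead of an alias of the   *)
(* function type, which already carries the pointwise ring structure.         *)
Record fps (I : choiceType) (R : comNzRingType) : Type :=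
  Fps { fcoef : {cmonom I} -> R }.

Section FpsRing.
Variables (I : choiceType) (R : comNzRingType).
Local Notation M := {cmonom I}.
Local Notation S := (fps I R).
Implicit Types (f g h : S) (m : M).

Lemma fpsP f g : (forall m, fcoef f m = fcoef g m) -> f = g.
Proof. by case: f g => [f] [g] /= /funext->. Qed.

HB.instance Definition _ := gen_eqMixin S.
HB.instance Definition _ := gen_choiceMixin S.

Definition fps0 : S := Fps (fun _ => 0).
Definition fpsN f : S := Fps (fun m => - fcoef f m).
Definition fpsD f g : S := Fps (fun m => fcoef f m + fcoef g m).

Fact fpsDA : associative fpsD.
Proof. by move=> f g h; apply: fpsP => m /=; rewrite addrA. Qed.
Fact fpsDC : commutative fpsD.
Proof. by move=> f g; apply: fpsP => m /=; rewrite addrC. Qed.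
Fact fps0D : left_id fps0 fpsD.
Proof. by move=> f; apply: fpsP => m /=; rewrite add0r. Qed.
Fact fpsND : left_inverse fps0 fpsN fpsD.
Proof. by move=> f; apply: fpsP => m /=; rewrite addNr. Qed.

HB.instance Definition _ := GRing.isZmodule.Build S fpsDA fpsDC fps0D fpsND.

Definition factors2 m : set (M * M) := [set p | mmul p.1 p.2 = m].

Lemma factors2_finite m : finite_set (factors2 m).
Proof.
pose T := {ffun finsupp m -> 'I_(mdeg m).+1}.
pose q (p : M * M) : T * T :=
  ([ffun i => inord (p.1 (val i))], [ffun i => inord (p.2 (val i))]).
have le_deg (a b : M) i : mmul a b = m -> (a i <= mdeg m)%N.
  move=> <-; rewrite mdegM; apply: (leq_trans _ (leq_addr _ _)).
  case: (boolP (i \in finsupp a)) => [ia|]; last by rewrite memNfinsupp => /eqP->.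
  by rewrite mdegE (big_fsetD1 i) //= leq_addr.
have aux (a b a' b' : M) : mmul a b = m -> mmul a' b' = m ->
    [ffun i : finsupp m => inord (a (val i))] = [ffun i => inord (a' (val i))]
      :> T -> a = a'.
  move=> ab a'b' eqa; apply/eqP/cmP => i.
  case: (boolP (i \in finsupp m)) => [im|].
    move/ffunP: eqa => /(_ [` im]%fset); rewrite !ffunE /=.
    move=> /(congr1 val) /=; rewrite !inordK // ltnS.
      exact: le_deg a'b'.
    exact: le_deg ab.
  rewrite memNfinsupp => /eqP mi.
  have : (mmul a b) i = 0%N by rewrite ab.
  have : (mmul a' b') i = 0%N by rewrite a'b'.
  by rewrite !cmM; case: (a i) (a' i) => [|?] [|?].
have qinj : {in factors2 m &, injective q}.
  move=> [a b] [a' b'] /set_mem/= ab /set_mem/= a'b' [eqa eqb].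
  by rewrite (aux a b a' b') // (aux b a b' a') // mulmC.
have := inj_card_eq qinj; rewrite card_eq_le => /andP[_ /card_le_finite].
by apply; exact: finite_finset.
Qed.

Definition fps1 : S := Fps (fun m => (m == mone)%:R).
Definition fpsM f g : S :=
  Fps (fun m => \sum_(p \in factors2 m) fcoef f p.1 * fcoef g p.2).

Let D m := fset_set (factors2 m).

Let inD m p : (p \in D m) = (mmul p.1 p.2 == m).
Proof.
rewrite in_fset_set; last exact: factors2_finite.
by apply/idP/eqP => [/set_mem|/mem_set].
Qed.

Let fcoefM f g m :
  fcoef (fpsM f g) m = \sum_(p <- D m) fcoef f p.1 * fcoef g p.2.
Proof. by rewrite /= fsbig_finite //; exact: factors2_finite. Qed.

Fact fpsMC : commutative fpsM.
Proof.
move=> f g; apply: fpsP => m; rewrite !fcoefM.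
rewrite [RHS](eq_bigr (fun p => fcoef f p.2 * fcoef g p.1)); last first.
  by move=> p _; rewrite mulrC.
rewrite -(big_map (fun p : M * M => (p.2, p.1)) xpredT
            (fun p => fcoef f p.1 * fcoef g p.2)).
apply/perm_big/uniq_perm; rewrite ?fset_uniq //.
  by rewrite map_inj_uniq ?fset_uniq // => -[? ?] [? ?] [-> ->].
move=> [a b]; apply/idP/mapP => [|[[c d] + [-> ->]]]; rewrite !inD /= => ab.
  by exists (b, a); rewrite // inD /= mulmC.
by rewrite mulmC.
Qed.

Fact fpsMA : associative fpsM.
Proof.
move=> f g h; apply: fpsP => m; rewrite !fcoefM.
under eq_bigr do rewrite fcoefM mulr_sumr.
under [RHS]eq_bigr do rewrite fcoefM mulr_suml.
pose F (t : M * M * M) := fcoef f t.1.1 * fcoef g t.1.2 * fcoef h t.2.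
rewrite -(big_allpairs_dep (h := fun p q : M * M => (q.1, q.2, p.2)) (F := F)).
under eq_bigr do under eq_bigr do rewrite mulrA.
rewrite -(big_allpairs_dep (h := fun p q : M * M => (p.1, q.1, q.2)) (F := F)).
apply/perm_big/uniq_perm.
- apply: allpairs_uniq_dep => [|p _|[p q] [p' q']]; rewrite ?fset_uniq //.
  move=> /allpairsPdep[[a b] [[c d] [_ + [-> ->]]]].
  move=> + /allpairsPdep[[a' b'] [[c' d'] [_ + [-> ->]]]].
  by rewrite !inD /= => /eqP<- /eqP<- [-> -> ->].
- apply: allpairs_uniq_dep => [|p _|[p q] [p' q']]; rewrite ?fset_uniq //.
  move=> /allpairsPdep[[a b] [[c d] [_ + [-> ->]]]].
  move=> + /allpairsPdep[[a' b'] [[c' d'] [_ + [-> ->]]]].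
  by rewrite !inD /= => /eqP<- /eqP<- [-> -> ->].
move=> [[a b] c]; apply/allpairsPdep/allpairsPdep.
  move=> [[a' d] [[b' c'] [+ + [-> -> ->]]]].
  rewrite !inD /= => /eqP<- /eqP<-.
  by exists (mmul a' b', c'), (a', b'); rewrite !inD /= mulmA.
move=> [[d c'] [[a' b'] [+ + [-> -> ->]]]].
rewrite !inD /= => /eqP<- /eqP<-.
by exists (a', mmul b' c'), (b', c'); rewrite !inD /= mulmA.
Qed.

Fact fps1M : left_id fps1 fpsM.
Proof.
move=> f; apply: fpsP => m; rewrite fcoefM (big_fsetD1 (mone, m)) /=; last first.
  by rewrite inD /= mul1m.
rewrite eqxx mul1r big1_fset ?addr0 // => -[a b].
rewrite in_fsetD1 inD /= => /andP[neq /eqP abm] _.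
case: (a =P mone) neq => [a1|_ _]; last by rewrite mul0r.
by rewrite -abm a1 mul1m eqxx.
Qed.

Fact fpsMDl : left_distributive fpsM fpsD.
Proof.
move=> f g h; apply: fpsP => m /=; rewrite !fsbig_finite /=;
  do ?exact: factors2_finite.
by rewrite -big_split; apply: eq_bigr => p _ /=; rewrite mulrDl.
Qed.

Fact fps1_neq0 : fps1 != 0 :> S.
Proof.
apply/eqP => /(congr1 (fun f => fcoef f mone)) /=.
by rewrite eqxx => /eqP; rewrite oner_eq0.
Qed.

HB.instance Definition _ := GRing.Zmodule_isComNzRing.Build S
  fpsMA fpsMC fps1M fpsMDl fps1_neq0.

Definition fps_unit : {pred S} := fun f => `[< exists g : S, g * f = 1 >].
Definition fps_inv f : S := xget f [set g : S | g * f = 1].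

Fact fps_mulVx : {in fps_unit, left_inverse 1 fps_inv *%R}.
Proof. by move=> f /asboolP[g gf]; rewrite /fps_inv; case: xgetP => // /(_ g). Qed.

Fact fps_unitPl f g : g * f = 1 -> fps_unit f.
Proof. by move=> gf; apply/asboolP; exists g. Qed.

Fact fps_inv_out : {in [predC fps_unit], fps_inv =1 id}.
Proof.
move=> f /asboolPn nf; rewrite /fps_inv; case: xgetP => // g _ gf.
by case: nf; exists g.
Qed.

HB.instance Definition _ := GRing.ComNzRing_hasMulInverse.Build S
  fps_mulVx fps_unitPl fps_inv_out.

Definition fpsX (i : I) : S := Fps (fun m => (m == ucm i)%:R).

(* Convergence in the product topology, coefficients being discrete.          *)
Definition fps_cvg (u : nat -> S) (f : S) : Prop :=
  forall m, exists N, forall n, (N <= n)%N -> fcoef (u n) m = fcoef f m.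

Definition fps_summable (J : choiceType) (A : set J) (F : J -> S) : Prop :=
  forall m, finite_set [set j | A j /\ fcoef (F j) m != 0].

(* Meaningful for summable families only: the finitely supported sum on the   *)
(* right is 0 by convention when its support is infinite.                     *)
Definition fps_sum (J : choiceType) (A : set J) (F : J -> S) : S :=
  Fps (fun m => \sum_(j \in A) fcoef (F j) m).

End FpsRing.

(* The n-term continued fraction                                              *)
(*   a j / (b j - a j.+1 / (b j.+1 - ... - a (j + n).-1 / b (j + n).-1))      *)
Fixpoint cfrac_from (R : unitRingType) (a b : nat -> R) (n j : nat) : R :=
  if n is n'.+1 then a j / (b j - cfrac_from a b n' j.+1) else 0.

(* f = a 0 / (b 0 - a 1 / (b 1 - a 2 / (b 2 - ...))), as the limit of the     *)
(* truncations. The first clause makes every division in them a genuine one.  *)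
Definition is_cfrac (I : choiceType) (R : comNzRingType)
    (a b : nat -> fps I R) (f : fps I R) : Prop :=
  (forall n j, b j - cfrac_from a b n j.+1 \is a GRing.unit) /\
  fps_cvg (fun n => cfrac_from a b n 0) f.

Definition avoids132 (n : nat) (p : 'S_n) : Prop :=
  ~ exists a b c : 'I_n, [/\ (a < b < c)%N & (p a < p c < p b)%N].

(* e_k; the value at k = 0 is never used. For k >= 3, the tuple js lists      *)
(* j_3, ..., j_k and i' is i + 1.                                             *)
Definition occ (n : nat) (p : 'S_n) (k : nat) : nat :=
  match k with
  | 0 => 0
  | 1 => n
  | 2 => #|[pred i : 'I_n |
            [exists i' : 'I_n, (i' == i.+1 :> nat) && (p i < p i')%N]]|
  | k'.+3 => #|[pred t : 'I_n * k'.+1.-tuple 'I_n |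
      let: (i, js) := t in
      [exists i' : 'I_n,
        [&& i' == i.+1 :> nat,
            sorted ltn (i.+1 :: [seq val j | j <- js]) &
            sorted ltn [:: val (p i), val (p i') & [seq val (p j) | j <- js]]]]]|
  end%N.

Lemma occ_gt (n : nat) (p : 'S_n) (k : nat) : (n < k)%N -> occ p k = 0%N.
Proof.
case: k => [|[|[|k]]] //= nk; first by case: n p nk.
  apply: eq_card0 => i; rewrite !inE; apply/existsP => -[j /andP[/eqP ji _]].
  by have := leq_trans (ltn_ord j) nk; rewrite ji ltnS.
apply: eq_card0 => -[i js]; rewrite !inE; apply/existsP => -[j /and3P[_ _]].
pose s := [:: val (p i), val (p j) & [seq val (p l) | l <- js]].
move=> srt; have {srt} us : uniq s.
  by apply: (@sorted_uniq _ ltn) => //; [exact: ltn_trans | exact: ltnn].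
have ss : {subset s <= iota 0 n}.
  move=> y; rewrite mem_iota add0n leq0n !inE /=.
  by case/or3P => [/eqP->|/eqP->|/mapP[l _ ->]]; exact: ltn_ord.
have := uniq_leq_size us ss.
by rewrite /= size_map size_tuple size_iota => /(leq_trans nk); rewrite ltnn.
Qed.

(* x_1, x_2, ... are the indeterminates indexed by 0, 1, ...; xvar 0 is never *)
(* used.                                                                      *)
Definition xvar (k : nat) : fps nat int := fpsX int k.-1.

Definition S132 : set {n : nat & 'S_n} := [set s | avoids132 (tagged s)].

(* The product over k >= 1 may stop at the length n, see occ_gt.              *)
Definition weight (s : {n : nat & 'S_n}) : fps nat int :=
  \prod_(1 <= k < (tag s).+1) xvar k ^+ occ (tagged s) k.

Definition Pmon (n : nat) : fps nat int :=
  \prod_(k < n.+1) xvar k.+2 ^+ 'C(n, k).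

(* Main.v *)
From HB Require Import structures.
Require Import Defs.
From mathcomp Require Import all_boot all_order all_algebra all_fingroup finmap.
From mathcomp Require Import boolp classical_sets functions cardinality fsbigop.
From mathcomp Require Import xfinmap monalg zify ring.

Set Implicit Arguments.
Unset Strict Implicit.
Unset Printing Implicit Defensive.

Import GRing.Theory.

(** The skew sum of two permutations puts the letters of the first one above
    and to the left of those of the second one.  A nonempty 132-avoiding
    permutation is L n R with n its largest letter, that is, the skew sum of
    L n and R, with L and R avoiding 132.  The number of occurrences of
    12-3-...-k is additive on skew sums, and L n has those of L together with
    those of 12-3-...-(k-1) in L followed by n; for k = 2 the latter are a
    single ascent when L is nonempty.  Hence passing from L n to L replaces x_k
    by x_k x_(k+1) for k >= 2.  Let F_m be the generating function after m such
    replacements, which take x_2 to P_m.  Then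
    F_m = 1 + x_1 (1 + P_m (F_(m+1) - 1)) F_m, that is
    F_m (1 - x_1 + x_1 P_m - x_1 P_m F_(m+1)) = 1.  Iterating this relation
    gives the continued fraction, and it converges because each level
    contributes a factor x_1 to the error. *)

(** * Statistics on words *)

(* The number of increasing subsequences of length r with letters above x. *)
Fixpoint nincr (r x : nat) (s : seq nat) : nat :=
  match r, s with
  | 0, _ => 1
  | _, [::] => 0
  | r'.+1, y :: s' => (if x < y then nincr r' y s' else 0) + nincr r x s'
  end.

(* The number of occurrences of 12-3-...-(r+2). *)
Fixpoint nocc (r : nat) (s : seq nat) : nat :=
  if s is x :: s' then
    (if s' is y :: s'' then if x < y then nincr r y s'' else 0 else 0)
      + nocc r s'
  else 0.

Lemma nincr0 x s : nincr 0 x s = 1.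
Proof. by case: s. Qed.

Lemma nincr_le r x s : all (geq x) s -> nincr r.+1 x s = 0.
Proof. by elim: s => //= y s IH /andP[yx /IH ->]; rewrite ltnNge yx. Qed.

Lemma nincr_oversize r x s : size s < r -> nincr r x s = 0.
Proof.
elim: s r x => [|y s IH] [|r] x //=; rewrite ltnS => sr.
by rewrite !IH ?if_same //; exact: ltnW.
Qed.

Lemma nocc_oversize r s : size s <= r.+1 -> nocc r s = 0.
Proof.
elim: s => //= x [|y s] //= IH; rewrite ltnS => sr.
by rewrite IH ?nincr_oversize ?if_same //; exact: ltnW.
Qed.

Lemma nincr_map f r x s : {mono f : a b / a < b} ->
  nincr r (f x) (map f s) = nincr r x s.
Proof.
move=> fm; elim: s r x => [|y s IH] [|r] x //=.
by rewrite fm IH -[nincr r.+1 x s]IH.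
Qed.

Lemma nocc_map f r s : {mono f : a b / a < b} -> nocc r (map f s) = nocc r s.
Proof.
by move=> fm; elim: s => //= x [|y s] //= ->; rewrite fm nincr_map.
Qed.

Lemma nincr_cat r x L R : allrel gtn (x :: L) R ->
  nincr r x (L ++ R) = nincr r x L.
Proof.
elim: L r x => [|y L IH] [|r] x; rewrite ?nincr0 // !allrel_consl.
  move=> /andP[xR _]; apply: nincr_le; apply: sub_all xR => z.
  exact: ltnW.
by move=> /and3P[xR yR LR] /=; rewrite !IH // allrel_consl ?xR ?yR.
Qed.

Lemma nocc_cat r L R : allrel gtn L R -> nocc r (L ++ R) = nocc r L + nocc r R.
Proof.
elim: L => // x [|y L] IH.
  rewrite allrel_consl andbT; case: R {IH} => //= y R /andP[yx _].
  by rewrite ltnNge ltnW.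
rewrite allrel_consl => /andP[_ yLR]; have /= -> := IH yLR.
by rewrite nincr_cat // addnA.
Qed.

Lemma nincr_rcons r x n s : all (gtn n) (x :: s) ->
  nincr r x (rcons s n) =
  nincr r x s + (if r is r'.+1 then nincr r' x s else 0).
Proof.
elim: s r x => [|y s IH] [|r] x; rewrite ?nincr0 //=.
  by rewrite andbT => ->; case: r.
move=> /and3P[xn yn sn]; rewrite !IH /= ?xn ?yn //.
by case: ifP => _; case: r => [|r] //=; rewrite ?nincr0; lia.
Qed.

Lemma nocc_rcons r n s : all (gtn n) s ->
  nocc r (rcons s n) =
  nocc r s + (if r is r'.+1 then nocc r' s else s != [::]).
Proof.
elim: s => [|x [|y s] IH]; first by case: r.
  by rewrite /= andbT => ->; case: r {IH} => [|r].
move=> /andP[_ ysn]; have /= -> := IH ysn; rewrite nincr_rcons //.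
by case: (x < y); case: r {IH} => [|r] /=; rewrite ?nincr0; lia.
Qed.

(** * Words avoiding 132 *)

Fixpoint av132 (s : seq nat) : bool :=
  if s is x :: s' then pairwise leq [seq y <- s' | x < y] && av132 s' else true.

Lemma av132_map f s : {mono f : a b / a < b} -> av132 (map f s) = av132 s.
Proof.
move=> fm; elim: s => //= x s ->; congr (_ && _).
rewrite filter_map pairwise_map (eq_filter (fm x)).
by apply: eq_pairwise => y z; rewrite /= leqNgt fm -leqNgt.
Qed.

Lemma av132_cat L R : allrel gtn L R -> av132 (L ++ R) = av132 L && av132 R.
Proof.
elim: L => //= x L IH; rewrite allrel_consl => /andP[xR LR].
have no_larger : [seq z <- R | x < z] = [::].
  rewrite -(filter_pred0 R); apply: eq_in_filter => z /(allP xR) /= zx.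
  by rewrite ltnNge ltnW.
by rewrite IH // filter_cat no_larger cats0 andbA.
Qed.

Lemma av132_rcons n s : all (gtn n) s -> av132 (rcons s n) = av132 s.
Proof.
elim: s => //= x s IH /andP[xn sn]; rewrite IH // filter_rcons xn.
rewrite pairwise_rcons; congr (_ && _).
rewrite andb_idl // => _; apply/allP => y.
by rewrite mem_filter => /andP[_ /(allP sn) /ltnW].
Qed.

Lemma av132_allrel_max n L R : uniq (L ++ R) -> all (gtn n) (L ++ R) ->
  av132 (L ++ n :: R) -> allrel gtn L R.
Proof.
elim: L => //= x L IH /andP[xLR uLR] /andP[xn LRn].
move=> /andP[x_incr /(IH uLR LRn) LR].
rewrite allrel_consl LR andbT; apply/allP => z zR /=.
have zn : z < n by apply: (allP LRn); rewrite mem_cat zR orbT.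
rewrite ltn_neqAle; apply/andP; split.
  by apply: contraNneq xLR => <-; rewrite mem_cat zR orbT.
rewrite leqNgt; apply: contraTN zn => xz; rewrite -leqNgt.
move: x_incr; rewrite filter_cat /= xn pairwise_cat /=.
move=> /and4P[_ _ /allP nR _].
by apply: nR; rewrite mem_filter xz.
Qed.

(* A word of length n whose letters are 0, ..., n - 1. *)
Definition perm_word (s : seq nat) : bool := perm_eq s (iota 0 (size s)).

Lemma perm_word_uniq s : perm_word s -> uniq s.
Proof. by move=> /perm_uniq ->; exact: iota_uniq. Qed.

Lemma mem_perm_word s x : perm_word s -> (x \in s) = (x < size s).
Proof. by move=> /perm_mem ->; rewrite mem_iota. Qed.

Lemma perm_word_lt s : perm_word s -> all (gtn (size s)) s.
Proof. by move=> sP; apply/allP => x; rewrite mem_perm_word. Qed.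

Definition skew_sum (L R : seq nat) : seq nat := map (addn (size R)) L ++ R.

Lemma allrel_skew_sum L R : perm_word R ->
  allrel gtn (map (addn (size R)) L) R.
Proof.
move=> /perm_word_lt/allP R_lt; apply/allrelP => _ z /mapP[y _ ->] /R_lt /= zR.
exact: ltn_addr.
Qed.

Lemma perm_word_skew_sum L R : perm_word R ->
  perm_word (skew_sum L R) = perm_word L.
Proof.
move=> RP; have mono := perm_map_inj (@addnI (size R)).
rewrite /perm_word size_cat size_map addnC iotaD.
rewrite perm_catC (permPl (perm_cat RP (perm_refl _))) perm_cat2l.
rewrite add0n -[X in iota X]addn0 iotaDl.
by apply/idP/idP => [/mono|/perm_map].
Qed.

Lemma perm_word_insert_max L R :
  perm_word (L ++ size L + size R :: R) = perm_word (L ++ R).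
Proof.
rewrite /perm_word !size_cat addnS -addn1 iotaD -cat1s perm_catCA.
by rewrite perm_sym perm_catC perm_cat2l perm_sym.
Qed.

Lemma perm_word_rcons s : perm_word (rcons s (size s)) = perm_word s.
Proof. by have := perm_word_insert_max s [::]; rewrite addn0 cats0 cats1. Qed.

Lemma perm_word_cat_skew L R : perm_word (L ++ R) -> allrel gtn L R ->
  exists2 L', L = map (addn (size R)) L' & perm_word L' && perm_word R.
Proof.
move=> LRP /allrelP LR.
have : sort leq R ++ sort leq L = iota 0 (size R) ++ iota (size R) (size L).
  rewrite -iotaD addnC -size_cat; apply: (sorted_eq leq_trans anti_leq).
  - rewrite (sorted_pairwise leq_trans) pairwise_cat.
    rewrite -!(sorted_pairwise leq_trans) !sort_sorted //; try exact: leq_total.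
    rewrite !andbT; apply/allrelP => x y; rewrite !mem_sort => xR yL.
    exact/ltnW/LR.
  - exact: iota_sorted.
  - apply: perm_trans LRP; rewrite perm_catC.
    by apply: perm_cat; exact/permEl/perm_sort.
move/eqP; rewrite eqseq_cat ?size_sort ?size_iota // => /andP[/eqP RE /eqP LE].
have RP : perm_word R by rewrite /perm_word -RE perm_sym perm_sort.
pose L' := [seq x - size R | x <- L].
have L'E : L = map (addn (size R)) L'.
  rewrite -map_comp -[LHS]map_id; apply/eq_in_map => x.
  by rewrite -(mem_sort leq) LE mem_iota => /andP[/subnKC].
by exists L'; rewrite // RP andbT -(perm_word_skew_sum L' RP) /skew_sum -L'E.
Qed.

(* In terms of direct and skew sums of permutations, (L (+) 1) (-) R. *)
Definition join_max (L R : seq nat) : seq nat := skew_sum (rcons L (size L)) R.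

Lemma size_join_max L R : size (join_max L R) = (size L + size R).+1.
Proof. by rewrite size_cat size_map size_rcons addSn. Qed.

Lemma perm_word_join_max L R : perm_word L -> perm_word R ->
  perm_word (join_max L R).
Proof. by move=> LP RP; rewrite perm_word_skew_sum // perm_word_rcons. Qed.

Lemma av132_join_max L R : perm_word L -> perm_word R ->
  av132 (join_max L R) = av132 L && av132 R.
Proof.
move=> LP RP; rewrite av132_cat ?allrel_skew_sum // av132_map; last first.
  exact: ltn_add2l.
by rewrite av132_rcons // perm_word_lt.
Qed.

Lemma index_join_max L R : perm_word L ->
  index (size L + size R) (join_max L R) = size L.
Proof.
move=> LP; rewrite addnC /join_max /skew_sum map_rcons cat_rcons index_cat ifN.
  by rewrite size_map /= eqxx addn0.
by rewrite (mem_map (@addnI _)) mem_perm_word // ltnn.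
Qed.

Lemma join_max_inj L L' R R' : size L = size L' ->
  join_max L R = join_max L' R' -> L = L' /\ R = R'.
Proof.
move=> sL E; have := congr1 size E; rewrite !size_join_max sL.
move=> /succn_inj /addnI sR; move/eqP: E.
rewrite eqseq_cat ?size_map ?size_rcons ?sL // sR => /andP[/eqP + /eqP ->].
by move=> /(inj_map (@addnI _)) /rcons_inj[->].
Qed.

Lemma av132_is_join_max s : perm_word s -> av132 s -> s != [::] ->
  exists L R, [/\ s = join_max L R, perm_word L && av132 L
                                  & perm_word R && av132 R].
Proof.
move=> sP av; rewrite -size_eq0 -lt0n => /prednK/esym.
move: (size s).-1 => n sn.
have ns : n \in s by rewrite mem_perm_word // sn.
case/splitPr: ns sP av sn => L R + + /eqP.
rewrite size_cat /= addnS eqSS => + + /eqP nE; rewrite -{}nE.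
rewrite perm_word_insert_max => LRP av.
have LR_lt := perm_word_lt LRP; rewrite size_cat in LR_lt.
have LR : allrel gtn (rcons L (size L + size R)) R.
  rewrite -cats1 allrel_catl allrel1l (av132_allrel_max _ LR_lt) //.
    by move: LR_lt; rewrite all_cat => /andP[].
  exact: perm_word_uniq.
move: av; rewrite -perm_word_insert_max -cat_rcons in LRP *.
have [L1 L1E] := perm_word_cat_skew LRP LR.
case/lastP: L1 L1E => [/(congr1 size)|L2 a]; rewrite ?size_rcons //.
rewrite map_rcons => /rcons_inj[LE]; rewrite LE size_map addnC => /addnI <-.
rewrite perm_word_rcons => /andP[L2P RP]; rewrite -map_rcons.
rewrite -/(join_max L2 R) av132_join_max // => /andP[avL avR].
by exists L2, R; rewrite L2P RP avL avR.
Qed.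

Definition av132_words (n : nat) : seq (seq nat) :=
  [seq s <- permutations (iota 0 n) | av132 s].

Lemma mem_av132_words n s :
  (s \in av132_words n) = [&& size s == n, perm_word s & av132 s].
Proof.
rewrite mem_filter mem_permutations andbA [RHS]andbC /perm_word.
congr (_ && _); apply/idP/andP => [sn|[/eqP -> //]].
by have -> : size s = n by rewrite (perm_size sn) size_iota.
Qed.

Lemma av132_words_uniq n : uniq (av132_words n).
Proof. exact/filter_uniq/permutations_uniq. Qed.

Lemma perm_av132_words_index n k : k <= n ->
  perm_eq [seq s <- av132_words n.+1 | index n s == k]
          [seq join_max L R | L <- av132_words k, R <- av132_words (n - k)].
Proof.
move=> kn; apply: uniq_perm; first exact/filter_uniq/av132_words_uniq.
  apply: allpairs_uniq; try exact: av132_words_uniq.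
  move=> [L R] [L' R'] /allpairsP[[? ?] [/= + _ [-> _]]].
  move=> + /allpairsP[[? ?] [/= + _ [-> _]]].
  rewrite !mem_av132_words => /andP[/eqP sL _] /andP[/eqP sL' _].
  by move=> /join_max_inj[|-> ->]; rewrite // sL sL'.
move=> s; rewrite mem_filter mem_av132_words; apply/idP/allpairsP.
  move=> /and4P[/eqP ink /eqP sn sP av].
  have := av132_is_join_max sP av; rewrite -size_eq0 sn.
  move=> [//|L [R [sE /andP[LP avL] /andP[RP avR]]]].
  move: sn; rewrite sE size_join_max => -[sLR].
  have Lk : size L = k by rewrite -ink sE -sLR index_join_max.
  exists (L, R); rewrite /= !mem_av132_words LP avL RP avR Lk eqxx.
  by rewrite -sLR Lk addKn eqxx.
move=> [[L R] [/= + + ->]]; rewrite !mem_av132_words.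
move=> /and3P[/eqP Lk LP avL] /and3P[/eqP Rk RP avR].
have nE : n = size L + size R by rewrite Lk Rk subnKC.
rewrite nE index_join_max // size_join_max Lk !eqxx.
by rewrite perm_word_join_max // av132_join_max // avL avR.
Qed.

(** * Permutations as words *)

Lemma nincrE r x s :
  nincr r.+1 x s =
  \sum_(k < size s | x < nth 0 s k) nincr r (nth 0 s k) (drop k.+1 s).
Proof.
elim: s => [|y s IH] /=; first by rewrite big_ord0.
by rewrite big_mkcond big_ord_recl IH /= drop0 [X in _ + X = _]big_mkcond.
Qed.

Lemma noccE r s :
  nocc r s = \sum_(k < (size s).-1 | nth 0 s k < nth 0 s k.+1)
               nincr r (nth 0 s k.+1) (drop k.+2 s).
Proof.
elim: s => [|x [|y s] IH]; rewrite ?big_ord0 // [LHS]/=.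
rewrite -/(nocc r (y :: s)) IH big_mkcond [RHS]big_mkcond big_ord_recl /=.
by rewrite drop0.
Qed.

Lemma card_tuple_cons (T : finType) r (P : pred (seq T)) :
  #|[pred t : r.+1.-tuple T | P t]| =
  \sum_x #|[pred t : r.-tuple T | P (x :: t)]|.
Proof.
rewrite -sum1_card; under [RHS]eq_bigr do rewrite -sum1_card.
rewrite pair_big_dep /=.
rewrite (reindex (fun q : T * r.-tuple T => [tuple of q.1 :: q.2])) //=.
exists (fun t : r.+1.-tuple T => (thead t, [tuple of behead t])).
  by move=> [x t] _ /=; rewrite theadE; congr (_, _); apply: val_inj.
by move=> t _; rewrite [in RHS](tuple_eta t); apply: val_inj.
Qed.

Lemma card_exists_le1 (T U : finType) (P : T -> pred U) :
  (forall x, #|P x| <= 1) ->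
  #|[pred x | [exists y, P x y]]| = \sum_x \sum_y P x y.
Proof.
move=> P1; rewrite -sum1_card big_mkcond; apply: eq_bigr => x _ /=.
rewrite inE -[RHS]big_mkcond sum1_card.
have := P1 x; case: existsP => [[y Py] Px1|nP _].
  by apply/eqP; rewrite eq_sym eqn_leq Px1; apply/card_gt0P; exists y.
by apply/esym/eq_card0 => y; apply/negP => Py; apply: nP; exists y.
Qed.

Section FunctionWords.
Variables (n : nat) (f : 'I_n -> nat).

Lemma size_codom_ord : size (codom f) = n.
Proof. by rewrite size_codom card_ord. Qed.

Lemma nth_codom_ord (i : 'I_n) : nth 0 (codom f) i = f i.
Proof. by rewrite (nth_map i) ?size_enum_ord // nth_ord_enum. Qed.

Definition noninversion : rel 'I_n := fun i j => (i < j) && (f i < f j).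

Lemma path_noninversion i js :
  path noninversion i js =
  path ltn (val i) (map val js) && path ltn (f i) (map f js).
Proof. by elim: js i => //= j js IH i; rewrite IH andbACA. Qed.

Lemma nincr_codom r (i : 'I_n) :
  nincr r (f i) (drop i.+1 (codom f)) =
  #|[pred js : r.-tuple 'I_n | path noninversion i js]|.
Proof.
elim: r i => [|r IH] i.
  rewrite nincr0 (@fintype.eq_card1 _ [tuple]) // => t.
  by rewrite tuple0 !inE eqxx.
rewrite nincrE (card_tuple_cons _ (path noninversion i)).
rewrite size_drop size_codom_ord.
pose incr_after j := nincr r (nth 0 (codom f) j) (drop j.+1 (codom f)).
transitivity (\sum_(i.+1 <= j < n | f i < nth 0 (codom f) j) incr_after j).
  rewrite -[i.+1]add0n big_addn big_mkord add0n.
  apply: eq_big => k; rewrite nth_drop addnC // => _.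
  by rewrite drop_drop /incr_after addSn.
rewrite big_geq_mkord big_mkcond; apply: eq_bigr => j _.
rewrite nth_codom_ord andbC /incr_after nth_codom_ord IH /= /noninversion.
by case: (_ && _) => //; rewrite eq_card0.
Qed.

Lemma nocc_codom r :
  nocc r (codom f) =
  \sum_(i : 'I_n) \sum_(j : 'I_n | (j == i.+1 :> nat) && (f i < f j))
    #|[pred js : r.-tuple 'I_n | path noninversion j js]|.
Proof.
under [RHS]eq_bigr do under eq_bigr do rewrite -nincr_codom.
rewrite noccE size_codom_ord; case: n f (nth_codom_ord) => [|n'] g nthg.
  by rewrite !big_ord0.
rewrite [RHS]big_ord_recr [X in _ = _ + X]big_pred0 ?addn0 /=; last first.
  by move=> j; rewrite ltn_eqF.
rewrite big_mkcond; apply: eq_bigr => k _.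
rewrite big_mkcondr (big_pred1 (lift ord0 k)); last first.
  by move=> j; rewrite /= -val_eqE.
by rewrite -!nthg.
Qed.

End FunctionWords.

Definition word n (p : 'S_n) : seq nat := codom (val \o p).

Lemma size_word n (p : 'S_n) : size (word p) = n.
Proof. exact: size_codom_ord. Qed.

Lemma nth_word n (p : 'S_n) (i : 'I_n) : nth 0 (word p) i = p i.
Proof. exact: nth_codom_ord. Qed.

Lemma card_ord_succ_le1 n (i : 'I_n) (Q : pred 'I_n) :
  #|[pred j : 'I_n | (j == i.+1 :> nat) && Q j]| <= 1.
Proof.
apply/card_le1_eqP => j k; rewrite !inE => /andP[/eqP ji _] /andP[/eqP ki _].
by apply: val_inj; rewrite /= ji ki.
Qed.

Lemma occ_word n (p : 'S_n) r : occ p r.+2 = nocc r (word p).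
Proof.
rewrite nocc_codom; case: r => [|r] /=.
  rewrite card_exists_le1 => [|i]; last exact: card_ord_succ_le1.
  apply: eq_bigr => i _; rewrite [RHS]big_mkcond; apply: eq_bigr => j _ /=.
  by rewrite -nincr_codom nincr0; case: (_ && _).
pose chain (t : 'I_n * r.+1.-tuple 'I_n) (j : 'I_n) :=
  (j == t.1.+1 :> nat) &&
  ((p t.1 < p j) && path (noninversion (val \o p)) j t.2).
transitivity #|[pred t | [exists j, chain t j]]|.
  apply: eq_card => -[i js]; rewrite !inE; apply: eq_existsb => j.
  by rewrite /chain path_noninversion /=; case: eqP => //= <-; rewrite andbCA.
rewrite card_exists_le1 => [|t]; last exact: card_ord_succ_le1.
rewrite -(pair_big xpredT xpredT (fun i js => \sum_j chain (i, js) j)) /=.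
apply: eq_bigr => i _; rewrite exchange_big [RHS]big_mkcond.
apply: eq_bigr => j _; rewrite -sum1_card [in RHS]big_mkcond /= /chain.
case: ifP => /= ij; last first.
  by apply: big1 => js _; rewrite andbA ij.
by apply: eq_bigr => js _; rewrite inE andbA ij; case: path.
Qed.

Lemma pairwise_filterE (T : Type) (P : pred T) (r : rel T) s :
  pairwise r (filter P s) = pairwise (fun y z => P y && P z ==> r y z) s.
Proof.
elim: s => //= x s <-; case: (P x) => /=; last by rewrite all_predT.
by rewrite all_filter.
Qed.

Lemma av132P s :
  reflect (forall a b c, a < b < c -> c < size s ->
             ~~ (nth 0 s a < nth 0 s c < nth 0 s b)) (av132 s).
Proof.
apply: (iffP idP).
  elim: s => //= x s IH; rewrite pairwise_filterE.
  move=> /andP[/(pairwiseP 0) xs /IH {}IH] [|a] [|b] [|c];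
    rewrite ?ltn0 ?andbF //=; last by rewrite !ltnS; exact: IH.
  rewrite !ltnS => bc cs; have := xs b c (ltn_trans bc cs) cs bc.
  by lia.
elim: s => //= x s IH no132; apply/andP; split.
  rewrite pairwise_filterE; apply/(pairwiseP 0) => b c bs cs bc.
  by have := no132 0 b.+1 c.+1 bc cs => /=; lia.
by apply: IH => a b c abc cs; exact: (no132 a.+1 b.+1 c.+1).
Qed.

Lemma avoids132_word n (p : 'S_n) : avoids132 p <-> av132 (word p).
Proof.
split=> [av|/av132P av].
  apply/av132P => a b c abc; rewrite size_word => cn.
  have bn : b < n by lia.
  have an : a < n by lia.
  apply/negP => acb; apply: av; exists (Ordinal an), (Ordinal bn), (Ordinal cn).
  by split=> //; rewrite -!nth_word.
move=> [a [b [c [abc pabc]]]]; have := av a b c abc.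
by rewrite size_word !nth_word pabc => /(_ (ltn_ord c)).
Qed.

Lemma word_inj n : injective (@word n).
Proof.
move=> p q pq; apply/permP => i; apply: val_inj.
by rewrite /= -!nth_word pq.
Qed.

Lemma perm_eq_words n :
  perm_eq [seq word p | p <- enum 'S_n] (permutations (iota 0 n)).
Proof.
have u_words : uniq [seq word p | p <- enum 'S_n].
  by rewrite (map_inj_uniq (@word_inj n)) enum_uniq.
apply: uniq_perm; rewrite ?permutations_uniq //.
apply: (uniq_min_size u_words _ _).2 => [_ /mapP[p _ ->]|].
  rewrite mem_permutations; have u_word : uniq (word p).
    by apply/injectiveP => i j /val_inj /perm_inj.
  apply: uniq_perm; rewrite ?iota_uniq //.
  apply: (uniq_min_size u_word _ _).2; last by rewrite size_word size_iota.
  by move=> _ /codomP[i ->]; rewrite mem_iota /=.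
by rewrite size_permutations ?iota_uniq // size_iota size_map -cardE card_Sn.
Qed.

Lemma perm_eq_av132_words n :
  perm_eq [seq word p | p <- enum 'S_n & `[< avoids132 p >]] (av132_words n).
Proof.
have -> : [seq p <- enum 'S_n | `[< avoids132 p >]] =
    [seq p <- enum 'S_n | av132 (word p)].
  by apply: eq_filter => p; apply/asboolP/idP => /avoids132_word.
by rewrite -(filter_map (@word n)) perm_filter // perm_eq_words.
Qed.

Local Open Scope ring_scope.

(** * Weights *)

Section Weight.
Variable A : comNzRingType.
Implicit Types (z : A) (y : nat -> A) (s L R : seq nat).

(* A larger letter put on the right of a word keeps each occurrence of        *)
(* 12-3-...-k and extends it to one of 12-3-...-(k+1): on the variables, y r  *)
(* marking 12-3-...-(r+2), this is the substitution of y r * y r.+1 for y r.  *)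
Definition mul_next y : nat -> A := fun r => y r * y r.+1.

Lemma iter_mul_next y m r :
  iter m mul_next y r = \prod_(k < m.+1) y (r + k)%N ^+ 'C(m, k).
Proof.
elim: m r => [|m IH] r; first by rewrite big_ord1 addn0 expr1.
rewrite iterS /mul_next !IH big_ord_recl [RHS]big_ord_recl !bin0.
under [in RHS]eq_bigr do rewrite lift0 binS exprD.
rewrite big_split /= [X in _ = _ * (X * _)]big_ord_recr /= bin_small // mulr1.
rewrite !mulrA; congr (_ * _ * _).
by apply: eq_bigr => k _; rewrite addSnnS.
Qed.

Definition wt z y s : A := z ^+ size s * \prod_(r < size s) y r ^+ nocc r s.

Lemma wt_nil z y : wt z y [::] = 1.
Proof. by rewrite /wt big_ord0 mulr1. Qed.

Lemma wt_widen z y s N : ((size s).-1 <= N)%N ->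
  wt z y s = z ^+ size s * \prod_(r < N) y r ^+ nocc r s.
Proof.
have trunc m : ((size s).-1 <= m)%N ->
    \prod_(r < m) y r ^+ nocc r s = \prod_(r < (size s).-1) y r ^+ nocc r s.
  move=> sm; rewrite [RHS](big_ord_widen m (fun r => y r ^+ nocc r s)) //.
  rewrite [RHS]big_mkcond; apply: eq_bigr => r _; case: ltnP => // sr.
  by rewrite nocc_oversize // -ltnS; lia.
by move=> sN; rewrite /wt trunc ?leq_pred // trunc.
Qed.

Lemma wt_map f z y s : {mono f : a b / (a < b)%N} ->
  wt z y (map f s) = wt z y s.
Proof.
move=> fm; rewrite /wt size_map; congr (_ * _).
by apply: eq_bigr => r _; rewrite nocc_map.
Qed.

Lemma wt_cat z y L R : allrel gtn L R -> wt z y (L ++ R) = wt z y L * wt z y R.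
Proof.
move=> LR; pose N := (size L + size R)%N.
rewrite !(@wt_widen _ _ _ N) ?size_cat; try by rewrite /N; lia.
under eq_bigr do rewrite nocc_cat // exprD.
by rewrite big_split exprD mulrACA.
Qed.

Lemma wt_rcons z y n s : all (gtn n) s ->
  wt z y (rcons s n) =
  z * (if s is [::] then 1 else y 0 * wt z (mul_next y) s).
Proof.
move=> sn; rewrite (@wt_widen _ _ _ (size s).+1) ?size_rcons //.
under eq_bigr do rewrite nocc_rcons // exprD.
rewrite exprS -mulrA; congr (_ * _); rewrite big_split big_ord_recr /=.
rewrite (@nocc_oversize (size s)) // expr0 mulr1 big_ord_recl /=.
rewrite !(mulrCA _ (y 0%N ^+ _)) -big_split /=.
case: s {sn} => [|x s]; first by rewrite big_ord0 !mulr1.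
rewrite expr1; congr (_ * (_ * _)).
by apply: eq_bigr => r _; rewrite exprMn.
Qed.

Lemma wt_join_max z y L R : perm_word L -> perm_word R ->
  wt z y (join_max L R) = wt z y (rcons L (size L)) * wt z y R.
Proof.
move=> LP RP; rewrite wt_cat ?allrel_skew_sum // wt_map //; exact: ltn_add2l.
Qed.

Definition av132_sum z y (n : nat) : A := \sum_(s <- av132_words n) wt z y s.

Lemma av132_sum0 z y : av132_sum z y 0 = 1.
Proof. by rewrite /av132_sum big_seq1 wt_nil. Qed.

Lemma av132_sum_rcons z y k :
  \sum_(L <- av132_words k) wt z y (rcons L k) =
  z * (if k is 0 then 1 else y 0 * av132_sum z (mul_next y) k).
Proof.
transitivity (\sum_(L <- av132_words k)
    z * (if k is 0 then 1 else y 0 * wt z (mul_next y) L)).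
  apply: eq_big_seq => L; rewrite mem_av132_words => /and3P[/eqP <- LP _].
  by rewrite wt_rcons ?perm_word_lt //; case: L {LP}.
rewrite -mulr_sumr; congr (_ * _).
by case: k => [|k]; [rewrite big_seq1 | rewrite -mulr_sumr].
Qed.

Lemma av132_sum_join_max z y n :
  av132_sum z y n.+1 =
  \sum_(k < n.+1) (\sum_(L <- av132_words k) wt z y (rcons L k)) *
                  av132_sum z y (n - k).
Proof.
rewrite /av132_sum.
rewrite (partition_big (fun s => inord (index n s) : 'I_n.+1) xpredT) //.
apply: eq_bigr => k _; have kn : (k <= n)%N by rewrite -ltnS.
rewrite -big_filter (eq_in_filter (a2 := fun s => index n s == k)); last first.
  move=> s; rewrite mem_av132_words => /and3P[/eqP sn sP _].
  by rewrite -val_eqE /= inordK // -sn index_mem mem_perm_word // sn.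
rewrite (perm_big _ (perm_av132_words_index kn)) big_allpairs_dep big_distrlr.
apply: eq_big_seq => L; rewrite mem_av132_words => /and3P[/eqP sL LP _].
apply: eq_big_seq => R; rewrite mem_av132_words => /and3P[_ RP _].
by rewrite wt_join_max // sL.
Qed.

Lemma av132_sumS z y n :
  av132_sum z y n.+1 =
  z * \sum_(k < n.+1)
        (if k : nat is 0 then 1 else y 0 * av132_sum z (mul_next y) k) *
        av132_sum z y (n - k).
Proof.
rewrite av132_sum_join_max mulr_sumr; apply: eq_bigr => k _.
by rewrite av132_sum_rcons mulrA.
Qed.

End Weight.

Arguments mul_next {A}.

(** * Power series graded by the degree in one indeterminate *)

Section DegreeInX.
Variables (I : choiceType) (R : comNzRingType) (i : I).
Local Notation S := (fps I R).
Implicit Types (f g c : S) (m : {cmonom I}) (u v : nat -> S) (A B C : pred nat).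

Lemma fcoefB f g m : fcoef (f - g) m = fcoef f m - fcoef g m.
Proof. by []. Qed.

Lemma fcoef1 m : fcoef (1 : S) m = (m == mone)%:R.
Proof. by []. Qed.

Lemma in_factors2 m p :
  (p \in fset_set (factors2 m)) = (mmul p.1 p.2 == m).
Proof.
rewrite in_fset_set; last exact: factors2_finite.
by apply/idP/eqP => [/set_mem|/mem_set].
Qed.

Lemma fcoefM f g m :
  fcoef (f * g) m =
  \sum_(p <- fset_set (factors2 m)) fcoef f p.1 * fcoef g p.2.
Proof. by rewrite /= fsbig_finite //; exact: factors2_finite. Qed.

Lemma fcoef_sum (J : Type) (r : seq J) (P : pred J) (F : J -> S) m :
  fcoef (\sum_(j <- r | P j) F j) m = \sum_(j <- r | P j) fcoef (F j) m.
Proof. by elim/big_rec2: _ => // j y1 y2 _ <-. Qed.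

Definition fps_degree_in A : {pred S} :=
  [pred f | `[< forall m, ~~ A (m i) -> fcoef f m = 0 >]].

Lemma fps_degree_inP A f :
  reflect (forall m, ~~ A (m i) -> fcoef f m = 0) (f \in fps_degree_in A).
Proof. exact: asboolP. Qed.

Fact fps_degree_in_zmod_closed A : zmod_closed (fps_degree_in A).
Proof.
split=> [|f g /fps_degree_inP fA /fps_degree_inP gA].
  exact/fps_degree_inP.
by apply/fps_degree_inP => m mA; rewrite fcoefB fA // gA // subrr.
Qed.

HB.instance Definition _ A :=
  GRing.isZmodClosed.Build S (fps_degree_in A) (fps_degree_in_zmod_closed A).

Lemma fps_degree_inM A B C f g :
  (forall a b, A a -> B b -> C (a + b)%N) ->
  f \in fps_degree_in A -> g \in fps_degree_in B -> f * g \in fps_degree_in C.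
Proof.
move=> ABC /fps_degree_inP fA /fps_degree_inP gB; apply/fps_degree_inP => m mC.
rewrite fcoefM big1_seq // => p /andP[_]; rewrite in_factors2 => /eqP pm.
case: (boolP (A (p.1 i))) => [p1A|/fA->]; last by rewrite mul0r.
rewrite gB ?mulr0 //; apply: contra mC => p2B.
by rewrite -pm cmM ABC.
Qed.

Definition fps_homog (d : nat) : {pred S} := fps_degree_in (pred1 d).

Definition fps_order_ge (N : nat) : {pred S} := fps_degree_in (leq N).

Lemma fps_homog_degree d f m : f \in fps_homog d -> fcoef f m != 0 -> m i = d.
Proof.
by move=> /fps_degree_inP fd; apply: contraNeq => md; apply/eqP/fd.
Qed.

Lemma fps_homogM d e f g :
  f \in fps_homog d -> g \in fps_homog e -> f * g \in fps_homog (d + e).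
Proof. by apply: fps_degree_inM => a b /= /eqP-> /eqP->. Qed.

Lemma fps_homog1 : 1 \in fps_homog 0.
Proof.
apply/fps_degree_inP => m; rewrite fcoef1.
by case: (m =P _) => // -> /=; rewrite cm1.
Qed.

Lemma fps_homog_fpsX j : fpsX R j \in fps_homog (i == j).
Proof.
apply/fps_degree_inP => m; rewrite /fpsX /=; case: (m =P _) => // ->.
by rewrite cmU eq_sym [j == i]eq_sym; case: (i == j).
Qed.

Lemma fps_homog_prod (J : Type) (r : seq J) (P : pred J) (d : J -> nat)
    (F : J -> S) :
  (forall j, P j -> F j \in fps_homog (d j)) ->
  \prod_(j <- r | P j) F j \in fps_homog (\sum_(j <- r | P j) d j).
Proof.
move=> F_homog; elim/big_rec2: _ => [|j e f Pj]; first exact: fps_homog1.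
exact/fps_homogM/F_homog.
Qed.

Lemma fps_homogXn d f n : f \in fps_homog d -> f ^+ n \in fps_homog (n * d).
Proof.
move=> fd; elim: n => [|n IH]; first exact: fps_homog1.
by rewrite exprS mulSn fps_homogM.
Qed.

Lemma fps_order_geM N K f g :
  f \in fps_order_ge N -> g \in fps_order_ge K ->
  f * g \in fps_order_ge (N + K).
Proof. by apply: fps_degree_inM => a b; exact: leq_add. Qed.

Lemma fps_order_geMr N f g : f \in fps_order_ge N -> f * g \in fps_order_ge N.
Proof.
by move=> fN; rewrite -[N]addn0 fps_order_geM //; exact/fps_degree_inP.
Qed.

Lemma fps_order_geXn N f : f \in fps_order_ge 1 -> f ^+ N \in fps_order_ge N.
Proof.
move=> f1; elim: N => [|N IH]; first exact/fps_degree_inP.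
by rewrite exprS -add1n fps_order_geM.
Qed.

Lemma fps_homog_order_ge d f : f \in fps_homog d -> f \in fps_order_ge d.
Proof.
move=> /fps_degree_inP fd; apply/fps_degree_inP => m md; apply: fd.
by apply: contra md => /= /eqP->.
Qed.

Lemma fps_order_ge_eq0 f : (forall N, f \in fps_order_ge N) -> f = 0.
Proof.
move=> f_ge; apply: fpsP => m.
by have /fps_degree_inP-> := f_ge (m i).+1; rewrite // ltnn.
Qed.

Definition fps_geom f : S :=
  Fps (fun m => \sum_(k < (m i).+1) fcoef (f ^+ k) m).

Lemma fps_geom_approx N f : f \in fps_order_ge 1 ->
  fps_geom f - \sum_(k < N) f ^+ k \in fps_order_ge N.
Proof.
move=> f1; apply/fps_degree_inP => m; rewrite -ltnNge => mN; apply/eqP.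
rewrite fcoefB subr_eq0 fcoef_sum; apply/eqP.
rewrite [LHS](big_ord_widen N (fun k => fcoef (f ^+ k) m)) // big_mkcond.
apply: eq_bigr => k _; case: ltnP => // mk.
by have /fps_degree_inP-> := fps_order_geXn k f1; rewrite // -ltnNge.
Qed.

Lemma mul_fps_geom f : f \in fps_order_ge 1 -> (1 - f) * fps_geom f = 1.
Proof.
move=> f1; apply/eqP; rewrite -subr_eq0; apply/eqP/fps_order_ge_eq0 => N.
pose t := \sum_(k < N) f ^+ k.
have tE : (1 - f) * t = 1 - f ^+ N by rewrite -opprB mulNr -subrX1 opprB.
have -> : (1 - f) * fps_geom f - 1 =
    (fps_geom f - t) * (1 - f) + ((1 - f) * t - 1) by ring.
rewrite tE addrAC subrr add0r rpredB ?fps_order_geXn //.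
exact/fps_order_geMr/fps_geom_approx.
Qed.

Lemma fps_order_ge1_unit f : f \in fps_order_ge 1 -> 1 - f \is a GRing.unit.
Proof.
by move=> f1; apply/unitrPr; exists (fps_geom f); exact: mul_fps_geom.
Qed.

(* Meaningful when u n is homogeneous of degree n: it is then the sum of u.   *)
Definition graded_sum u : S := Fps (fun m => fcoef (u (m i)) m).

Lemma eq_graded_sum u v : u =1 v -> graded_sum u = graded_sum v.
Proof. by move=> uv; apply: fpsP => m /=; rewrite uv. Qed.

Lemma graded_sumD u v :
  graded_sum u + graded_sum v = graded_sum (fun n => u n + v n).
Proof. exact: fpsP. Qed.

Lemma fps_homog_graded_sum d c :
  c \in fps_homog d -> c = graded_sum (fun n => c *+ (n == d)).
Proof.
by move=> /fps_degree_inP cd; apply: fpsP => m /=; case: eqVneq => // /cd ->.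
Qed.

Lemma graded_sumM u v :
  (forall n, u n \in fps_homog n) -> (forall n, v n \in fps_homog n) ->
  graded_sum u * graded_sum v =
  graded_sum (fun n => \sum_(k < n.+1) u k * v (n - k)%N).
Proof.
move=> u_homog v_homog; apply: fpsP => m; rewrite fcoefM /= fcoef_sum.
under [RHS]eq_bigr do rewrite fcoefM.
rewrite exchange_big /=; apply: eq_big_seq => p; rewrite in_factors2 => /eqP pm.
have mE : m i = (p.1 i + p.2 i)%N by rewrite -pm cmM.
have p1m : (p.1 i < (m i).+1)%N by rewrite mE ltnS leq_addr.
have p2E : (m i - p.1 i)%N = p.2 i by rewrite mE addKn.
rewrite (bigD1 (Ordinal p1m)) //= p2E big1 ?addr0 // => k kp1.
have /fps_degree_inP-> := u_homog k; rewrite ?mul0r //.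
by rewrite /= eq_sym.
Qed.

Lemma fps_homog_graded_sumM d c u : c \in fps_homog d ->
  c * graded_sum u =
  graded_sum (fun n => if (d <= n)%N then c * u (n - d)%N else 0).
Proof.
move=> /fps_degree_inP cd; apply: fpsP => m; rewrite fcoefM.
transitivity (\sum_(p <- fset_set (factors2 m))
    if (d <= m i)%N then fcoef c p.1 * fcoef (u (m i - d)%N) p.2 else 0).
  apply: eq_big_seq => p; rewrite in_factors2 => /eqP <- /=; rewrite cmM.
  have [<-|p1d] := eqVneq (p.1 i) d; first by rewrite leq_addr addKn.
  by rewrite cd ?mul0r ?if_same.
by rewrite [RHS]/=; case: ifP => _; rewrite ?fcoefM ?big1_eq.
Qed.

Lemma fps_summable_graded (T : nat -> finType) (A : set {n & T n})
    (F : {n & T n} -> S) :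
  (forall t, F t \in fps_homog (tag t)) -> fps_summable A F.
Proof.
move=> F_homog m; pose fiber := [set existT T (m i) t | t in setT]%classic.
apply: (@sub_finite_set _ _ fiber); last exact/finite_image/finite_finset.
move=> [n t] [_ Ftm]; have nE : m i = n := fps_homog_degree (F_homog _) Ftm.
by move: t Ftm; rewrite -nE => t _; exists t.
Qed.

Lemma fps_sum_graded (T : nat -> finType) (A : set {n & T n})
    (F : {n & T n} -> S) :
  (forall t, F t \in fps_homog (tag t)) ->
  fps_sum A F = graded_sum (fun n =>
    \sum_(t : T n | `[< A (existT T n t) >]) F (existT T n t)).
Proof.
move=> F_homog; apply: fpsP => m /=; rewrite fcoef_sum; set n := m i.
pose r := [seq existT T n t | t <- enum (T n) & `[< A (existT T n t) >]].
transitivity (\sum_(t <- r) fcoef (F t) m); last first.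
  by rewrite big_map big_filter big_enum_cond.
have ur : uniq r.
  rewrite map_inj_uniq; first exact/filter_uniq/enum_uniq.
  by move=> t t' /eqP; rewrite eq_Tagged => /eqP.
rewrite (fsbig_seq _ _ ur); apply/esym/fsbig_widen.
  by move=> _ /mapP[t + ->]; rewrite mem_filter => /andP[/asboolP].
move=> [k t] [/= At nr]; apply: contrapT => /eqP Ftm.
have kE : n = k := fps_homog_degree (F_homog _) Ftm.
apply: nr; move: t At Ftm; rewrite -kE => t At _; apply/mapP; exists t => //.
by rewrite mem_filter mem_enum andbT; apply/asboolP.
Qed.

End DegreeInX.

(** * Continued fractions from two-term recurrences *)

Section ContinuedFraction.
Variables (I : choiceType) (R : comNzRingType) (i : I).
Variables (a b F : nat -> fps I R).
Hypothesis a_order : forall j, a j.+1 \in fps_order_ge i 1.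
Hypothesis b_order : forall j, 1 - b j \in fps_order_ge i 1.
Hypothesis F_rec : forall j, F j * (b j - a j.+1 * F j.+1) = 1.

Lemma cfrac_denom_unit n j : b j - cfrac_from a b n j.+1 \is a GRing.unit.
Proof.
have tail_order : cfrac_from a b n j.+1 \in fps_order_ge i 1.
  by case: n => [|n] /=; [exact: rpred0 | exact: fps_order_geMr].
have -> : b j - cfrac_from a b n j.+1 = 1 - ((1 - b j) + cfrac_from a b n j.+1).
  by ring.
by apply: (@fps_order_ge1_unit _ _ i); rewrite rpredD.
Qed.

Lemma cfrac_errorS n j :
  cfrac_from a b n.+1 j - a j * F j =
  (cfrac_from a b n j.+1 - a j.+1 * F j.+1) *
    (a j * F j / (b j - cfrac_from a b n j.+1)).
Proof.
have den_unit := cfrac_denom_unit n j.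
apply: (mulIr den_unit); rewrite -mulrA divrK // mulrBl /= divrK //.
by rewrite -{1}[a j]mulr1 -(F_rec j); ring.
Qed.

Lemma cfrac_error_order n j :
  cfrac_from a b n j.+1 - a j.+1 * F j.+1 \in fps_order_ge i n.
Proof.
elim: n j => [|n IH] j; first exact/fps_degree_inP.
by rewrite cfrac_errorS -mulrA -[n.+1]addn1 fps_order_geM // fps_order_geMr.
Qed.

Lemma is_cfrac_recurrence : is_cfrac a b (a 0 * F 0).
Proof.
split=> [|m]; first exact: cfrac_denom_unit.
exists (m i).+2 => -[//|n] mn.
apply/eqP; rewrite -subr_eq0 -fcoefB cfrac_errorS.
have /fps_degree_inP-> // := fps_order_geMr
  (a 0 * F 0 / (b 0 - cfrac_from a b n 1)) (cfrac_error_order n 0).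
by rewrite -ltnNge.
Qed.

End ContinuedFraction.

(** * The generating function of the words avoiding 132 *)

Section GeneratingFunction.
Variables (I : choiceType) (R : comNzRingType) (i : I) (z : fps I R).
Hypothesis z_homog : z \in fps_homog i 1.
Implicit Types y : nat -> fps I R.

Lemma wt_homog y s : (forall r, y r \in fps_homog i 0) ->
  wt z y s \in fps_homog i (size s).
Proof.
move=> y0; rewrite -[size s]addn0 -{1}[size s]muln1; apply: fps_homogM.
  exact: fps_homogXn.
rewrite -[0%N](@big1_eq _ _ addn _ (index_enum 'I_(size s)) xpredT).
by apply: fps_homog_prod => r _; rewrite -(muln0 (nocc r s)) fps_homogXn.
Qed.

Lemma av132_sum_homog y n : (forall r, y r \in fps_homog i 0) ->
  av132_sum z y n \in fps_homog i n.
Proof.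
move=> y0; rewrite /av132_sum big_seq; apply: rpred_sum => s.
by rewrite mem_av132_words => /and3P[/eqP <- _ _]; exact: wt_homog.
Qed.

Lemma mul_next_homog y r : (forall r, y r \in fps_homog i 0) ->
  mul_next y r \in fps_homog i 0.
Proof. by move=> y0; exact: fps_homogM (y0 r) (y0 r.+1). Qed.

Definition av132_gf y : fps I R := graded_sum i (av132_sum z y).

Lemma av132_gf_rec y : (forall r, y r \in fps_homog i 0) ->
  av132_gf y * (1 - z + z * y 0 - z * y 0 * av132_gf (mul_next y)) = 1.
Proof.
move=> y0; have y'0 r := mul_next_homog r y0.
pose left n := if n is 0 then 1 else y 0 * av132_sum z (mul_next y) n.
have left_homog n : left n \in fps_homog i n.
  case: n => [|n]; first exact: fps_homog1.
  exact: fps_homogM (y0 0) (av132_sum_homog n.+1 y'0).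
have leftE : graded_sum i left = 1 - y 0 + y 0 * av132_gf (mul_next y).
  have y01 : 1 - y 0 \in fps_homog i 0 by rewrite rpredB ?fps_homog1.
  rewrite (fps_homog_graded_sumM _ (y0 0)).
  rewrite [1 - y 0](fps_homog_graded_sum y01) graded_sumD.
  apply: eq_graded_sum => -[|n]; rewrite /left ?subn0 ?add0r //.
  by rewrite av132_sum0 mulr1 subrK.
have gfE : av132_gf y = 1 + z * (graded_sum i left * av132_gf y).
  rewrite graded_sumM // => [|n]; last exact: av132_sum_homog.
  rewrite (fps_homog_graded_sumM _ z_homog).
  rewrite {1}(fps_homog_graded_sum (fps_homog1 R i)) graded_sumD.
  apply: eq_graded_sum => -[|n] /=; first by rewrite av132_sum0 addr0.
  by rewrite add0r subn1 av132_sumS.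
move: gfE; rewrite leftE; set f := av132_gf y; set g := av132_gf _ => gfE.
rewrite -[RHS](addrK (z * ((1 - y 0 + y 0 * g) * f))) -gfE.
by ring.
Qed.

Lemma av132_gf_cfrac y : (forall r, y r \in fps_homog i 0) ->
  is_cfrac (fun n => if n is m.+1 then z * iter m mul_next y 0 else 1)
           (fun n => 1 - z + z * iter n mul_next y 0) (av132_gf y).
Proof.
move=> y0; have z_order : z \in fps_order_ge i 1 by exact: fps_homog_order_ge.
have iter_homog m r : iter m mul_next y r \in fps_homog i 0.
  by elim: m r => [|m IH] r //; exact: mul_next_homog.
rewrite -[av132_gf y]mul1r.
pose F m := av132_gf (iter m mul_next y).
apply: (is_cfrac_recurrence (i := i) (F := F)) => m /=.
- exact: fps_order_geMr.
- have -> : 1 - (1 - z + z * iter m mul_next y 0) =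
            z - z * iter m mul_next y 0 by ring.
  by rewrite rpredB // fps_order_geMr.
- exact: av132_gf_rec.
Qed.

End GeneratingFunction.

Lemma Pmon_iter n : Pmon n = iter n mul_next (fun r => xvar r.+2) 0.
Proof. by rewrite iter_mul_next. Qed.

Lemma xvar1_homog : xvar 1 \in fps_homog 0%N 1.
Proof. exact: (fps_homog_fpsX int 0 0). Qed.

Lemma xvarSS_homog r : xvar r.+2 \in fps_homog 0%N 0.
Proof. exact: (fps_homog_fpsX int 0 r.+1). Qed.

Lemma weight_word (s : {n : nat & 'S_n}) :
  weight s = wt (xvar 1) (fun r => xvar r.+2) (word (tagged s)).
Proof.
case: s => n p; rewrite (@wt_widen _ _ _ _ n.-1) size_word // /weight /=.
case: n p => [|n] p; first by rewrite big_geq // big_ord0 mulr1.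
rewrite big_ltn // !big_add1 big_mkord; congr (_ * _).
by apply: eq_bigr => r _; rewrite -occ_word.
Qed.

Lemma weight_homog (s : {n : nat & 'S_n}) : weight s \in fps_homog 0%N (tag s).
Proof.
rewrite weight_word -{2}(size_word (tagged s)).
exact/(wt_homog xvar1_homog)/xvarSS_homog.
Qed.

Lemma fps_sum_weight :
  fps_sum S132 weight = av132_gf 0%N (xvar 1) (fun r => xvar r.+2).
Proof.
rewrite (fps_sum_graded _ weight_homog); apply: eq_graded_sum => n.
rewrite /av132_sum -(perm_big _ (perm_eq_av132_words n)) big_map.
rewrite big_filter big_enum_cond.
by apply: eq_bigr => p _; rewrite weight_word.
Qed.

Theorem theorem2p2 :
  fps_summable S132 weight /\
  is_cfrac (fun n => if n is m.+1 then xvar 1 * Pmon m else 1)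
           (fun n => 1 - xvar 1 + xvar 1 * Pmon n)
           (fps_sum S132 weight).
Proof.
split; first exact: fps_summable_graded weight_homog.
rewrite fps_sum_weight (funext Pmon_iter).
exact/(av132_gf_cfrac xvar1_homog)/xvarSS_homog.
Qed.
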